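(* Let $G$ be a finite weakly connected digraph with $w(G)>0$. Then there is an epimorphism $\varphi: G\to C_{w(G)}$. Conversely, let $S$ be the set of positive integers $n$ such that there is an epimorphism from $G$ to $C_n$; then $S$ is a finite set, and the largest integer of $S$ is equal to $w(G)$.
   Context: A digraph is a pair $G=(V,E)$ with $V$ a finite set and $E\subseteq V\times V$ (loops are allowed, multiple arcs are not). For an arc $(u,v)\in E$, $u$ is its initial vertex and $v$ its end vertex. The directed cycle $C_n$ ($n\ge 1$) is the digraph with vertex set $\{0,1,\dots,n-1\}$ and arcs $(0,1),(1,2),\dots,(n-2,n-1),(n-1,0)$; $C_1$ is a single vertex with a loop. A route $R=(S,\sigma)$ of length $n\ge 0$ in $G$ consists of a sequence of vertices $S=(v_0,\dots,v_n)$ and a sequence $\sigma=(\sigma_1,\dots,\sigma_n)\in\{1,-1\}^n$ such that, for each $i=1,\dots,n$, $(v_{i-1},v_i)\in E$ if $\sigma_i=1$ and $(v_i,v_{i-1})\in E$ if $\sigma_i=-1$. Its weight is $\sigma(R)=\sum_{i=1}^n\sigma_i$. The route is closed if $v_0=v_n$. $G$ is weakly connected if any two vertices are joined by a route. The weight of $G$ is $w(G)=\gcd(W)$, where $W$ is the set of positive integers $n$ such that some closed route $R$ in $G$ has $\sigma(R)=n$; if $W=\emptyset$, then $w(G)=0$. A homomorphism of digraphs $G_1\to G_2$ is a map sending vertices to vertices and arcs to arcs, compatible with taking initial vertices and end vertices of arcs. An epimorphism is a homomorphism that is surjective (on vertices and on arcs). *)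

(* Defs.v *)
From HB Require Import structures.
From mathcomp Require Import all_boot all_order all_algebra.
From mathcomp Require Import boolp classical_sets cardinality.

Set Implicit Arguments.
Unset Strict Implicit.
Unset Printing Implicit Defensive.

Import Order.TTheory GRing.Theory Num.Theory.

Local Open Scope classical_set_scope.

Record digraph := Digraph {
  vertex :> finType;
  arc : rel vertex
}.

Definition dicycle (n : nat) : digraph :=
  @Digraph 'I_n (fun i j => j == i.+1 %% n :> nat).

(* [widen_ord (leqnSn _) i] and [lift ord0 i] are the positions [i] and
   [i.+1] in the vertex sequence: signs are indexed from 0, so the step with
   sign number [i] joins these two vertices. *)
Record route (G : digraph) := Route {
  rlength : nat;
  rvertex : rlength.+1.-tuple G;
  rsign : rlength.-tuple int;
  routeP : forall i : 'I_rlength,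
    let u := tnth rvertex (widen_ord (leqnSn rlength) i) in
    let v := tnth rvertex (lift ord0 i) in
    [/\ tnth rsign i = 1%R \/ tnth rsign i = (-1)%R,
        tnth rsign i = 1%R -> arc u v &
        tnth rsign i = (-1)%R -> arc v u]
}.

Definition rstart (G : digraph) (R : route G) : G := tnth (rvertex R) ord0.

Definition rend (G : digraph) (R : route G) : G := tnth (rvertex R) ord_max.

Definition rweight (G : digraph) (R : route G) : int :=
  (\sum_(i < rlength R) tnth (rsign R) i)%R.

Definition rclosed (G : digraph) (R : route G) : Prop := rstart R = rend R.

Definition weakly_connected (G : digraph) : Prop :=
  forall u v : G, exists R : route G, rstart R = u /\ rend R = v.

Definition is_gcd (W : set nat) (d : nat) : Prop :=
  (forall n, W n -> d %| n) /\
  (forall e, (forall n, W n -> e %| n) -> e %| d).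

(* [gcd_setP] shows that the default value of [xget] is never used, and
   [gcd_set0] that the empty set has gcd 0. *)
Definition gcd_set (W : set nat) : nat := xget 0 [set d | is_gcd W d].

Lemma gcd_setP (W : set nat) : is_gcd W (gcd_set W).
Proof.
rewrite /gcd_set; case: xgetP => [d _ //|no_gcd]; exfalso.
have step n : 0 < n -> ~ (forall e, (forall m, W m -> e %| m) -> e %| n).
  elim/ltn_ind: n => n IHn n_gt0 n_ub.
  apply: (no_gcd n); split=> // m Wm; apply: contrapT => /negP ndm.
  apply: (IHn (gcdn n m)).
  - rewrite ltn_neqAle dvdn_leq ?dvdn_gcdl // andbT.
    by apply: contra ndm => /eqP <-; apply: dvdn_gcdr.
  - by rewrite gcdn_gt0 n_gt0.
  - by move=> e eW; rewrite dvdn_gcd n_ub // eW.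
apply: (no_gcd 0); split=> // m Wm.
case: (posnP m) => [-> //|m_gt0]; case: (step m m_gt0) => e; exact.
Qed.

Lemma gcd_set0 : gcd_set set0 = 0.
Proof. by apply/eqP; rewrite -dvd0n; apply: (gcd_setP set0).2. Qed.

Definition closed_weights (G : digraph) : set nat :=
  [set n | 0 < n /\ exists R : route G, rclosed R /\ rweight R = n%:Z%R].

Definition weight (G : digraph) : nat := gcd_set (closed_weights G).

(* There are no multiple arcs, so the action of a homomorphism on arcs is
   determined by its action on vertices. *)
Definition homomorphism (G1 G2 : digraph) (f : G1 -> G2) : Prop :=
  forall u v, arc u v -> arc (f u) (f v).

Definition epimorphism (G1 G2 : digraph) (f : G1 -> G2) : Prop :=
  [/\ homomorphism f,
      forall y, exists x, f x = y &
      forall y1 y2, arc y1 y2 -> exists x1 x2, [/\ arc x1 x2, f x1 = y1 & f x2 = y2]].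

Definition epi_cycle_lengths (G : digraph) : set nat :=
  [set n | 0 < n /\ exists f : G -> dicycle n, epimorphism f].

(* Main.v *)
From mathcomp Require Import all_boot all_order all_algebra.
From mathcomp Require Import boolp classical_sets cardinality.
From mathcomp Require Import zify ring.
Require Import Defs.

(** Everything rests on potentials modulo [d]: maps [g : G -> int] that grow by
    1 modulo [d] along every arc.  Along a route such a [g] changes by the
    weight of the route modulo [d] ([walk_potential]).

    Homomorphisms [G -> C_n] are potentials modulo [n].  A closed route leaves
    a potential unchanged, so [n] divides every closed weight, hence divides
    [weight G] ([homomorphism_dvd_weight]); as the latter is positive, this
    bounds [n].

    Conversely, weights of routes define a potential.  To obtain a homomorphism
    with [n = weight G] ([exists_homomorphism_weight]), fix a base vertex
    and send [v] to the weight, modulo [weight G], of any route from the base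
    to [v].  Two such routes differ by a closed route, whose weight is a
    multiple of [weight G] ([closed_walk_dvd_weight]), so the value is well
    defined, and prolonging a route by an arc shows that it grows by 1.

    Finally, any homomorphism [f : G -> C_n] is onto once [G] has a closed
    route of positive weight ([homomorphism_epi]).  If [f] missed the arc
    leaving [a], cutting the cycle at that arc would turn it into a path, so
    the position of [f v] on this path would be a potential modulo 0, that is,
    an exact one; then all closed routes would have weight 0. *)

Set Implicit Arguments.
Unset Strict Implicit.
Unset Printing Implicit Defensive.

Import Order.TTheory GRing.Theory Num.Theory.

(** * Routes as an inductive relation *)

Section Walks.
Local Open Scope ring_scope.

Definition step (G : digraph) (u v : G) (s : int) : Prop :=
  (s = 1 /\ arc u v) \/ (s = -1 /\ arc v u).

(** Remembering only the endpoints and the weight of a route turns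
    concatenation and reversal into plain inductions, free of tuples. *)
Inductive walk (G : digraph) : G -> G -> int -> Prop :=
| walk_nil u : walk u u 0
| walk_cons u v w s k of step u v s & walk v w k : walk u w (s + k).

Variable G : digraph.
Implicit Types (u v w : G) (s k : int).

Lemma walk_cat u v w k l : walk u v k -> walk v w l -> walk u w (k + l).
Proof.
elim=> [x|x y z s m xy _ IH] wl; first by rewrite add0r.
by rewrite -addrA; apply: walk_cons xy (IH wl).
Qed.

Lemma walk_step u v s : step u v s -> walk u v s.
Proof. by move=> uv; rewrite -[s]addr0; apply: walk_cons uv (walk_nil v). Qed.

Lemma step_rev u v s : step u v s -> step v u (- s).
Proof.
by case=> -[-> uv]; [right | left; rewrite opprK].
Qed.

Lemma walk_rev u v k : walk u v k -> walk v u (- k).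
Proof.
elim=> [x|x y z s m xy _ IH]; first by rewrite oppr0; apply: walk_nil.
by rewrite opprD addrC; apply: walk_cat IH (walk_step (step_rev xy)).
Qed.

Lemma route_step (R : route G) (i : 'I_(rlength R)) :
  step (tnth (rvertex R) (widen_ord (leqnSn _) i))
       (tnth (rvertex R) (lift ord0 i)) (tnth (rsign R) i).
Proof. by case: (routeP i) => -[e|e] H1 H2; [left|right]; auto. Qed.

Lemma walk_of_route (R : route G) : walk (rstart R) (rend R) (rweight R).
Proof.
(* The walk is built prefix by prefix; a sum over ['I_(rlength R)] filtered
   by [i < m] avoids changing the index type during the induction. *)
suff prefix m (m_lt : (m < (rlength R).+1)%N) :
    walk (rstart R) (tnth (rvertex R) (Ordinal m_lt))
      (\sum_(i < rlength R | (i < m)%N) tnth (rsign R) i).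
  have := prefix _ (ltnSn (rlength R)).
  rewrite (eq_bigl predT); last by move=> i; rewrite /= ltn_ord.
  by rewrite /rend (_ : Ordinal _ = ord_max) //; apply: val_inj.
elim: m m_lt => [|m IHm] m_lt.
  rewrite big_pred0 // /rstart (_ : Ordinal _ = ord0); last exact: val_inj.
  exact: walk_nil.
pose i : 'I_(rlength R) := Ordinal (m_lt : (m < rlength R)%N).
rewrite (bigD1 i) //= addrC.
rewrite (eq_bigl (fun j : 'I__ => (j < m)%N)); last first.
  by move=> j; rewrite ltnS -val_eqE /= ltn_neqAle andbC.
apply: walk_cat (IHm (ltnW m_lt)) (walk_step _); have := route_step i.
by congr step; congr tnth; apply: val_inj.
Qed.

Lemma route_cons u s (R : route G) : step u (rstart R) s ->
  exists R' : route G,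
    [/\ rstart R' = u, rend R' = rend R & rweight R' = s + rweight R].
Proof.
move=> us; pose S := [tuple of u :: rvertex R].
pose sg := [tuple of s :: rsign R].
have SP (i : 'I_(rlength R).+1) :
    let x := tnth S (widen_ord (leqnSn (rlength R).+1) i) in
    let y := tnth S (lift ord0 i) in
    [/\ tnth sg i = 1 \/ tnth sg i = -1,
        tnth sg i = 1 -> arc x y & tnth sg i = -1 -> arc y x].
  case: (unliftP ord0 i) => [j ->|->] /=.
    have -> : widen_ord (leqnSn (rlength R).+1) (lift ord0 j) =
              lift ord0 (widen_ord (leqnSn _) j) by apply: val_inj.
    by rewrite !tnthS; apply: routeP.
  have -> : widen_ord (leqnSn (rlength R).+1) ord0 = ord0 by apply: val_inj.
  rewrite !tnthS !tnth0; case: us => -[-> a]; split=> //; by [left|right].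
exists (Route SP); split.
- by rewrite /rstart /= tnth0.
- rewrite /rend /=.
  have -> : ord_max = lift ord0 (@ord_max (rlength R)) by apply: val_inj.
  by rewrite tnthS.
- rewrite /rweight /= big_ord_recl tnth0; congr (_ + _).
  by apply: eq_bigr => i _; rewrite tnthS.
Qed.

Lemma route_of_walk u v k : walk u v k ->
  exists R : route G, [/\ rstart R = u, rend R = v & rweight R = k].
Proof.
elim=> [x|x y z s m xy _ [R [RS RE RW]]].
  pose S := [tuple x]; pose sg : 0.-tuple int := [tuple].
  have P (i : 'I_0) : let a := tnth S (widen_ord (leqnSn 0) i) in
      let b := tnth S (lift ord0 i) in
      [/\ tnth sg i = 1 \/ tnth sg i = -1,
          tnth sg i = 1 -> arc a b & tnth sg i = -1 -> arc b a] by case: i.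
  by exists (Route P); split; rewrite // /rweight big_ord0.
rewrite -RS in xy; have [R' [R'S R'E R'W]] := route_cons xy.
by exists R'; rewrite R'S R'E R'W RE RW.
Qed.

(** Only positive weights enter the definition of [weight]; a walk of
    negative weight is handled by its reversal. *)
Lemma closed_walk_dvd_weight u k :
  walk u u k -> ((weight G)%:Z %| k)%Z.
Proof.
have pos n : (0 < n)%N -> walk u u n%:Z -> ((weight G)%:Z %| n%:Z)%Z.
  move=> n_gt0 /route_of_walk [R [RS RE RW]].
  apply: (gcd_setP (closed_weights G)).1; split=> //.
  by exists R; rewrite /rclosed RS RE.
case: k => [[|n]|n] wk; [exact: dvdz0 | exact: pos |].
by rewrite NegzE rpredN; apply: pos => //; have := walk_rev wk;
  rewrite NegzE opprK.
Qed.

Lemma exists_positive_closed_walk : (0 < weight G)%N ->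
  exists n (v : G), (0 < n)%N /\ walk v v n%:Z.
Proof.
move=> w_gt0; case: (pselect (exists n, closed_weights G n)).
  case=> n [n_gt0 [R [RC RW]]]; exists n, (rstart R); split=> //.
  by have := walk_of_route R; rewrite -RC RW.
move=> no_closed; suff w0 : weight G = 0%N by rewrite w0 in w_gt0.
rewrite /weight (_ : closed_weights G = set0) ?gcd_set0 //.
by rewrite -subset0 => n cn; apply: no_closed; exists n.
Qed.

(** * Potentials *)

(** The general modulus serves two purposes: [d = n] applies to homomorphisms to
    [C_n], and [d = 0] turns the congruence into an equality, as is needed for
    maps to a path. *)
Lemma walk_potential (d : int) (g : G -> int) u v k :
    (forall x y, arc x y -> (d %| g y - g x - 1)%Z) ->
  walk u v k -> (d %| g v - g u - k)%Z.
Proof.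
move=> gP; elim=> [x|x y z s m xy _ IH]; first by rewrite subrr subr0 dvdz0.
have -> : g z - g x - (s + m) = (g z - g y - m) + (g y - g x - s) by ring.
rewrite rpredD //; case: xy => -[-> a]; first exact: gP.
have -> : g y - g x - -1 = - (g x - g y - 1) by ring.
by rewrite rpredN gP.
Qed.

(** * Homomorphisms to directed cycles *)

Lemma dicycle_arcP n (i j : dicycle n) :
  reflect (nat_of_ord j = (i : 'I_n).+1 %% n)%N (arc i j).
Proof. exact: eqP. Qed.

Lemma homomorphism_potential n (f : G -> dicycle n) x y :
  homomorphism f -> arc x y ->
  (n%:Z %| (f y : 'I_n)%:Z - (f x : 'I_n)%:Z - 1)%Z.
Proof.
move=> fP /fP /dicycle_arcP ->.
by rewrite -addrA -opprD -eqz_mod_dvd -modz_nat addrC -intS modz_mod.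
Qed.

(** A closed walk returns to the same value of the potential [f], so [n] divides
    all closed weights and hence their gcd. *)
Lemma homomorphism_dvd_weight n (f : G -> dicycle n) :
  homomorphism f -> (n %| weight G)%N.
Proof.
move=> fP; apply: (gcd_setP (closed_weights G)).2 => m [_ [R [RC RW]]].
have := walk_of_route R; rewrite -RC RW => wk.
have := walk_potential (fun x y => @homomorphism_potential n f x y fP) wk.
by rewrite subrr sub0r rpredN.
Qed.

(** A homomorphism missing an arc of the cycle lands in a path, on which all
    closed walks have weight 0; onto vertices follows from onto arcs since every
    vertex of a cycle is the start of an arc. *)
Lemma homomorphism_epi n (f : G -> dicycle n) :
  (0 < weight G)%N -> homomorphism f -> epimorphism f.
Proof.
move=> w_gt0 fP.
have onto_arcs i j : arc i j -> exists u v, [/\ arc u v, f u = i & f v = j].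
  move=> ij; apply: contrapT => missed.
  (* Cutting the arc that leaves [i] makes [i] the last vertex of the path; the
     vertices after [i] are shifted by [- n] to come before vertex 0. *)
  pose g u : int :=
    (f u : 'I_n)%:Z - (if (i : 'I_n) < (f u : 'I_n) then n else 0)%N%:Z.
  have g_exact u v : arc u v -> (0 %| g v - g u - 1)%Z.
    move=> uv; have fu_neq : nat_of_ord (f u) <> i.
      move=> /val_inj fu; apply: missed; exists u, v; split=> //.
      apply: ord_inj; move/dicycle_arcP: ij => ->; rewrite -fu.
      exact/dicycle_arcP/fP.
    rewrite dvd0z; have /dicycle_arcP := fP _ _ uv.
    have := ltn_ord (f u : 'I_n); have := ltn_ord (i : 'I_n).
    rewrite /g; move: (nat_of_ord (f u)) (nat_of_ord (f v)) (nat_of_ord i) fu_neq.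
    move=> a b c ac cn an ->.
    (* The arc from [n.-1] to 0 is where the shift by [n] absorbs the wrap. *)
    have [a1n|a1n] := ltnP a.+1 n.
      rewrite modn_small //; case: (ltnP c a); case: (ltnP c a.+1) => *; lia.
    have a1E : a.+1 = n by lia.
    rewrite a1E modnn ltn0; case: (ltnP c a) => *; lia.
  have [m [u [m_gt0 /(walk_potential g_exact)]]] := exists_positive_closed_walk w_gt0.
  by rewrite subrr sub0r rpredN dvd0z; case: m m_gt0.
split=> // i.
have n_gt0 : (0 < n)%N by case: n i {f fP onto_arcs} => [[]|].
have [//|u [_ [_ fu _]]] := onto_arcs i (Ordinal (ltn_pmod i.+1 n_gt0)).
  exact/dicycle_arcP.
by exists u.
Qed.

(** The image of [v] is the weight modulo [weight G] of a chosen walk from a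
    base vertex [b]; for an arc from [u] to [v], the walk chosen for [u], the arc
    and the reversed walk chosen for [v] close up, which is what makes the choices
    compatible. *)
Lemma exists_homomorphism_weight :
  weakly_connected G -> (0 < weight G)%N ->
  exists f : G -> dicycle (weight G), homomorphism f.
Proof.
move=> Gc w_gt0; have [_ [b _]] := exists_positive_closed_walk w_gt0.
have /choice [h hP] v : exists k, walk b v k.
  by have [R [<- <-]] := Gc b v; exists (rweight R); apply: walk_of_route.
have r_lt v : (`|(h v %% (weight G)%:Z)%Z| < weight G)%N by lia.
exists (fun v => Ordinal (r_lt v) : 'I_(weight G)) => u v uv.
apply/dicycle_arcP => /=.
have : ((weight G)%:Z %| h u + 1 - h v)%Z.
  apply: (@closed_walk_dvd_weight b); apply: walk_cat (walk_rev (hP v)).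
  by apply: walk_cat (hP u) (walk_step _); left.
rewrite -eqz_mod_dvd => /eqP huv.
apply/eqP; rewrite -eqz_nat -modz_nat intS.
rewrite !gez0_abs ?modz_ge0 ?eqz_nat -?lt0n //.
by rewrite addrC modzDml huv.
Qed.

End Walks.

Theorem theorem1p6 (G : digraph) (G_connected : weakly_connected G)
    (w_gt0 : 0 < weight G) :
  (exists phi : G -> dicycle (weight G), epimorphism phi) /\
  [/\ finite_set (epi_cycle_lengths G),
      epi_cycle_lengths G (weight G) &
      forall n, epi_cycle_lengths G n -> n <= weight G].
Proof.
have [phi phi_hom] := exists_homomorphism_weight G_connected w_gt0.
have phi_epi := homomorphism_epi w_gt0 phi_hom.
have bound n : epi_cycle_lengths G n -> n <= weight G.
  move=> [n_gt0 [f [f_hom _ _]]].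
  exact: dvdn_leq w_gt0 (homomorphism_dvd_weight f_hom).
split; first by exists phi.
split=> //; last by split=> //; exists phi.
apply: (sub_finite_set _ (finite_II (weight G).+1)) => n /bound.
by rewrite /= ltnS.
Qed.
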